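(* Let $A\in\mathbb{R}^{n\times d}$, $k\ge1$, $0\le\epsilon<1$, $\delta\in(0,1)$, and let $R\in\mathbb{R}^{d'\times d}$ with $d'=O(\log(k/\delta)/\epsilon^2)$ be drawn from a Johnson-Lindenstrauss distribution. Let $\tilde A=AR^\top$. Let $S$ be the set of all $k$-cluster projection matrices, $P^*=\arg\min_{P\in S}\|A-PA\|_F^2$ and $\tilde P^*=\arg\min_{P\in S}\|\tilde A-P\tilde A\|_F^2$. Then with probability $1-\delta$, for every $\gamma\ge1$ and every $\tilde P\in S$ with $\|\tilde A-\tilde P\tilde A\|_F^2\le\gamma\|\tilde A-\tilde P^*\tilde A\|_F^2$, $$\|A-\tilde PA\|_F^2\le(9+\epsilon)\,\gamma\,\|A-P^*A\|_F^2.$$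
   Context: For a partition $C=\{C_1,\dots,C_k\}$ of the row indices $\{1,\dots,n\}$ into $k$ clusters, the cluster indicator matrix $X_C\in\mathbb{R}^{n\times k}$ has $X_C(i,j)=1/\sqrt{|C_j|}$ if row $i$ is in $C_j$ and $0$ otherwise; $X_CX_C^\top$ is a $k$-cluster projection matrix, and $\|A-X_CX_C^\top A\|_F^2$ equals the $k$-means cost of clustering the rows of $A$ by $C$. A Johnson-Lindenstrauss distribution is a distribution over $d'\times d$ matrices (for example, i.i.d. entries uniform in $\pm1/\sqrt{d'}$) such that for any fixed set of $N$ vectors (or any fixed matrix), with $d'=O(\log(N/\delta)/\epsilon^2)$ rows, all squared norms are preserved up to a factor $1\pm\epsilon$ with probability $1-\delta$. *)

(* Defs.v *)
From HB Require Import structures.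
From mathcomp Require Import all_boot all_order all_algebra.
From mathcomp Require Import all_classical all_reals all_analysis.

Set Implicit Arguments.
Unset Strict Implicit.
Unset Printing Implicit Defensive.

Import Order.TTheory GRing.Theory Num.Theory.

Local Open Scope classical_set_scope.
Local Open Scope ring_scope.

(* The squared Frobenius norm; on row vectors, the squared Euclidean norm. *)
Definition frob2 (K : realType) (m n : nat) (M : 'M[K]_(m, n)) : K :=
  \sum_(i < m) \sum_(j < n) M i j ^+ 2.

(* Injectivity makes the number of clusters exactly k; [finset.partition] already
   forbids empty clusters. *)
Definition is_clustering (n k : nat) (C : 'I_k -> {set 'I_n}) : Prop :=
  injective C /\ finset.partition [set C j | j : 'I_k]%SET [set: 'I_n]%SET.

Definition cluster_indicator (K : realType) (n k : nat)
    (C : 'I_k -> {set 'I_n}) : 'M[K]_(n, k) :=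
  \matrix_(i < n, j < k)
    (if i \in C j then (Num.sqrt (#|C j|%:R))^-1 else 0).

Definition cluster_projections (K : realType) (n k : nat) : set 'M[K]_n :=
  [set Q | exists C : 'I_k -> {set 'I_n}, is_clustering C /\
     Q = cluster_indicator K C *m (cluster_indicator K C)^T].
Arguments cluster_projections : clear implicits.

(* ||A - Q A||_F^2: the k-means cost of A when Q is a cluster projection. *)
Definition proj_cost (K : realType) (n d : nat) (A : 'M[K]_(n, d))
    (Q : 'M[K]_n) : K := frob2 (A - Q *m A).

Definition is_argmin (T : Type) (K : realType) (S : set T) (f : T -> K)
    (x : T) : Prop :=
  S x /\ forall y, S y -> f x <= f y.

Definition random_matrix (K : realType) (disp : measure_display)
    (T : measurableType disp) (m n : nat) (R : T -> 'M[K]_(m, n)) : Prop :=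
  forall i j, measurable_fun [set: T] (fun w => R w i j).

Definition norm_preserved (K : realType) (eps : K) (d' d m : nat)
    (R : 'M[K]_(d', d)) (M : 'M[K]_(m, d)) : Prop :=
  (1 - eps) * frob2 M <= frob2 (M *m R^T) <= (1 + eps) * frob2 M.

(* The Johnson-Lindenstrauss property of the law of R, where c is the constant
   hidden in the O of the number of rows, d' >= c log(N / delta) / eps^2.
   - A fixed matrix has a single (Frobenius) norm to preserve, i.e. N = 1.
   - delta is at most 1/2: when N / delta approaches 1 the prescribed number of
     rows degenerates to d' = 1, for which scaled random signs do not preserve
     norms with any positive probability, e.g. that of (1, 1). *)
Definition johnson_lindenstrauss (K : realType) (c : K)
    (disp : measure_display) (T : measurableType disp) (P : probability T K)
    (d' d : nat) (R : T -> 'M[K]_(d', d)) : Prop :=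
  forall eps delta : K, 0 < eps < 1 -> 0 < delta <= 2^-1 ->
  (forall (N : nat) (v : 'I_N -> 'rV[K]_d), (0 < N)%N ->
     c * ln (N%:R / delta) <= d'%:R * eps ^+ 2 ->
     ((1 - delta)%:E <=
        P [set w | forall i : 'I_N, norm_preserved eps (R w) (v i)])%E) /\
  (forall (m : nat) (M : 'M[K]_(m, d)),
     c * ln (1 / delta) <= d'%:R * eps ^+ 2 ->
     ((1 - delta)%:E <= P [set w | norm_preserved eps (R w) M])%E).

(* Main.v *)
(* Split A = P_opt A + (A - P_opt A). The matrix P_opt A has at most k distinct rows, and the
   cost of a projection is a nonnegative combination of squared distances between
   rows, so preserving the norms of the k^2 center differences preserves the cost
   of P_opt A for all projections at once; the norm of A - P_opt A is a single
   further norm to preserve, and projections do not increase it. Two triangle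
   inequalities, in the form |x + y|^2 <= (1 + t) |x|^2 + (1 + 1/t) |y|^2 with
   t = 1/2 and t = 1, then give (1 - e) cost(P) <= (9 + 3 e) gamma cost(P_opt), and
   e = eps / 13 suffices. With k = 1 there is only one projection; with k >= 2,
   ln (2 k^2 / delta) <= 3 ln (k / delta). *)
Require Import Defs.
From HB Require Import structures.
From mathcomp Require Import all_boot all_order all_algebra.
From mathcomp Require Import all_classical all_reals all_analysis.
From mathcomp Require Import ring lra.

Set Implicit Arguments.
Unset Strict Implicit.
Unset Printing Implicit Defensive.

Import Order.TTheory GRing.Theory Num.Theory.

Local Open Scope classical_set_scope.
Local Open Scope ring_scope.

(** * Frobenius norms and orthogonal projections *)

Section Frobenius.
Variable K : realType.

Lemma frob2_ge0 (m n : nat) (M : 'M[K]_(m, n)) : 0 <= frob2 M.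
Proof. by do 2!apply: sumr_ge0 => ? _; rewrite sqr_ge0. Qed.

Lemma frob2_mxtrace (m n : nat) (M : 'M[K]_(m, n)) : frob2 M = \tr (M *m M^T).
Proof.
apply: eq_bigr => i _; rewrite mxE; apply: eq_bigr => j _.
by rewrite mxE expr2.
Qed.

Lemma frob2N (m n : nat) (M : 'M[K]_(m, n)) : frob2 (- M) = frob2 M.
Proof. by do 2!apply: eq_bigr => ? _; rewrite mxE sqrrN. Qed.

Lemma frob2_rows (m n : nat) (M : 'M[K]_(m, n)) :
  frob2 M = \sum_i frob2 (row i M).
Proof.
apply: eq_bigr => i _; rewrite /frob2 big_ord1.
by apply: eq_bigr => j _; rewrite mxE.
Qed.

(** Entry by entry, the gap between the two sides is the square [(t * x - y) ^+ 2 / t]. *)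
Lemma frob2D_le (t : K) (m n : nat) (M N : 'M[K]_(m, n)) : 0 < t ->
  frob2 (M + N) <= (1 + t) * frob2 M + (1 + t^-1) * frob2 N.
Proof.
move=> t0; rewrite /frob2 !mulr_sumr -big_split /=; apply: ler_sum => i _.
rewrite !mulr_sumr -big_split /=; apply: ler_sum => j _; rewrite mxE -subr_ge0.
set x := M i j; set y := N i j.
have -> : (1 + t) * x ^+ 2 + (1 + t^-1) * y ^+ 2 - (x + y) ^+ 2
          = (t * x - y) ^+ 2 / t by field; rewrite gt_eqF.
by rewrite mulr_ge0 ?sqr_ge0// invr_ge0 ltW.
Qed.

(** Pythagoras in trace form: the three trace terms containing [Q] coincide by cyclicity and
    idempotence. *)
Lemma frob2_proj (n d : nat) (Q : 'M[K]_n) (M : 'M[K]_(n, d)) :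
  Q^T = Q -> Q *m Q = Q -> frob2 (M - Q *m M) = frob2 M - \tr (Q *m (M *m M^T)).
Proof.
move=> symQ idQ; rewrite !frob2_mxtrace linearB/= trmx_mul symQ.
rewrite mulmxBl !mulmxBr !raddfB/= !mulmxA.
rewrite -[Q *m M *m M^T *m Q]mulmxA -mulmxA -mulmxA.
rewrite [\tr (M *m (M^T *m Q))](_ : _ = \tr (Q *m (M *m M^T))); last first.
  by rewrite mulmxA mxtrace_mulC.
rewrite [\tr (Q *m (M *m (M^T *m Q)))](_ : _ = \tr (Q *m (M *m M^T))); last first.
  by rewrite mxtrace_mulC -!mulmxA idQ mulmxA mxtrace_mulC.
by ring.
Qed.

Lemma frob2_proj_le (n d : nat) (Q : 'M[K]_n) (M : 'M[K]_(n, d)) :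
  Q^T = Q -> Q *m Q = Q -> frob2 (M - Q *m M) <= frob2 M.
Proof.
move=> symQ idQ; rewrite frob2_proj// gerBl.
suff -> : \tr (Q *m (M *m M^T)) = frob2 (Q *m M) by exact: frob2_ge0.
rewrite frob2_mxtrace trmx_mul symQ -{1}idQ -!mulmxA mxtrace_mulC.
by rewrite !mulmxA.
Qed.

(* The cost of a cluster is the normalized sum of its pairwise squared distances. *)
Lemma proj_cost_pairs (n d : nat) (Q : 'M[K]_n) (M : 'M[K]_(n, d)) :
  Q^T = Q -> Q *m Q = Q -> (forall i, \sum_j Q i j = 1) ->
  proj_cost M Q = 2^-1 * \sum_i \sum_j Q i j * frob2 (row i M - row j M).
Proof.
move=> symQ idQ sumQ; rewrite /proj_cost frob2_proj//.
have sumQ' j : \sum_i Q i j = 1.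
  by rewrite -(sumQ j); apply: eq_bigr => i _; rewrite -{1}symQ mxE.
pose ip i j := (M *m M^T) i j.
have distE i j : frob2 (row i M - row j M) =
    frob2 (row i M) + frob2 (row j M) - 2 * ip j i.
  rewrite /frob2 !big_ord1 /ip mxE mulr_sumr -big_split/= -sumrB.
  by apply: eq_bigr => l _; rewrite !mxE; ring.
(* Unit row and column sums turn the two squared-norm terms into [frob2 M] each; the inner products
   give twice the trace, which the factor 1/2 absorbs. *)
under eq_bigr do under eq_bigr do rewrite distE mulrBr mulrDr.
under eq_bigr do rewrite sumrB big_split/= -mulr_suml sumQ mul1r.
rewrite sumrB big_split/= -frob2_rows [X in _ * (_ + X - _)]exchange_big/=.
under [X in _ * (_ + X - _)]eq_bigr do rewrite -mulr_suml sumQ' mul1r.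
rewrite -frob2_rows.
have -> : \sum_i \sum_j Q i j * (2 * ip j i) = 2 * \tr (Q *m (M *m M^T)).
  rewrite /mxtrace mulr_sumr; apply: eq_bigr => i _; rewrite mxE mulr_sumr.
  by apply: eq_bigr => j _; rewrite /ip; ring.
by field.
Qed.

Lemma proj_cost_mulr (n d e : nat) (A : 'M[K]_(n, d)) (B : 'M[K]_(d, e))
    (Q : 'M[K]_n) :
  proj_cost (A *m B) Q = frob2 ((A - Q *m A) *m B).
Proof. by rewrite /proj_cost mulmxBl mulmxA. Qed.

End Frobenius.

(** * Clusterings and their projection matrices *)

Section Clusterings.
Variables (n k : nat) (C : 'I_k -> {set 'I_n}).
Hypothesis clC : is_clustering C.

Lemma clustering_card_gt0 (j : 'I_k) : (0 < #|C j|)%N.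
Proof.
case: clC => _ /and3P[_ _ C0]; rewrite card_gt0; apply: contra C0 => /eqP <-.
exact: imset_f.
Qed.

(** Covering gives each row a cluster; disjointness and injectivity make it unique. Sums over
    clusters then have a single nonzero term. *)
Lemma clustering_index :
  exists f : 'I_n -> 'I_k, forall i j, (i \in C j) = (j == f i).
Proof.
case: clC => injC partC.
have /choice [f fP] (i : 'I_n) : exists j, i \in C j.
  have : i \in finset.cover [set C j | j : 'I_k]%SET.
    by rewrite (finset.cover_partition partC) finset.in_setT.
  by case/finset.bigcupP => _ /imsetP[j _ ->] iC; exists j.
exists f => i j; apply/idP/eqP => [iCj|->//]; apply: injC.
apply: contraTeq iCj => /(finset.trivIsetP (finset.partition_trivIset partC)).
move=> /(_ (imset_f _ _) (imset_f _ _)) dis; rewrite disjoint_sym in dis.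
by rewrite (disjointFr (dis _ _)).
Qed.

End Clusterings.

(** The normalized columns of [X] are orthonormal, so [X *m X^T] is an orthogonal projection; its
    row [i] equals 1/|C_j| on the cluster C_j of [i] and 0 elsewhere. *)
Lemma cluster_projection_facts (K : realType) (n k : nat) (Q : 'M[K]_n) :
  cluster_projections K n k Q ->
  [/\ Q^T = Q, Q *m Q = Q, forall i, \sum_j Q i j = 1 &
      forall i j, 0 <= Q i j].
Proof.
move=> [C [clC ->]]; set X := cluster_indicator K C.
have [f fP] := clustering_index clC.
pose s j : K := Num.sqrt #|C j|%:R.
have s0 j : s j != 0 by rewrite sqrtr_eq0 -ltNge ltr0n clustering_card_gt0.
have XE i j : X i j = if j == f i then (s j)^-1 else 0 by rewrite mxE fP.
have cardE j : \sum_i (j == f i)%:R = s j ^+ 2 :> K.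
  rewrite sqr_sqrtr// -natr_sum -sum1_card; congr (_%:R).
  by rewrite [RHS]big_mkcond; apply: eq_bigr => i _; rewrite fP; case: eqP.
have XtX : X^T *m X = 1%:M.
  apply/matrixP => a b; rewrite !mxE.
  under eq_bigr do rewrite mxE !XE.
  case: (eqVneq a b) => [->|ab].
    rewrite (eq_bigr (fun i => (b == f i)%:R * (s b)^-1 ^+ 2)).
      by rewrite -mulr_suml cardE -exprMn mulfV ?expr1n.
    by move=> i _; case: eqP => _; rewrite ?mul1r ?mul0r// expr2.
  apply: big1 => i _; case: (eqVneq a (f i)) => [<-|]; last by rewrite mul0r.
  by rewrite eq_sym (negbTE ab) mulr0.
split.
- by rewrite trmx_mul trmxK.
- by rewrite mulmxA -[X *m X^T *m X]mulmxA XtX mulmx1.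
- move=> i; under eq_bigr do rewrite mxE.
  rewrite exchange_big/= (bigD1 (f i))//= [X in _ + X]big1 ?addr0; last first.
    by move=> j jfi; apply: big1 => l _; rewrite XE (negbTE jfi) mul0r.
  rewrite (eq_bigr (fun l => (f i == f l)%:R * (s (f i))^-1 ^+ 2)).
    by rewrite -mulr_suml cardE -exprMn mulfV ?expr1n.
  move=> l _; rewrite [X^T _ _]mxE !XE eqxx.
  by case: eqP => _; rewrite ?mul1r ?mulr0 ?mul0r// expr2.
- move=> i j; rewrite mxE; apply: sumr_ge0 => l _; rewrite !mxE.
  by rewrite mulr_ge0//; case: ifP; rewrite ?invr_ge0 ?sqrtr_ge0.
Qed.

Lemma cluster_projection_rows (K : realType) (n k d : nat) (Q : 'M[K]_n)
    (A : 'M[K]_(n, d)) :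
  cluster_projections K n k Q ->
  exists (f : 'I_n -> 'I_k) (u : 'I_k -> 'rV[K]_d),
    forall i, row i (Q *m A) = u (f i).
Proof.
move=> [C [clC ->]]; have [f fP] := clustering_index clC; exists f.
set X := cluster_indicator K C.
(* The witness is the centroid of cluster [j]: one factor 1/sqrt|C_j| comes from each copy of
   [X]. *)
exists (fun j => (Num.sqrt #|C j|%:R)^-1 *: row j (X^T *m A)) => i.
rewrite -mulmxA; apply/rowP => l; rewrite !mxE.
rewrite (bigD1 (f i))//= big1 ?addr0; first by rewrite !mxE fP eqxx.
by move=> j jfi; rewrite !mxE fP (negbTE jfi) mul0r.
Qed.

Lemma cluster_projection1_uniq (K : realType) (n : nat) (Q Q' : 'M[K]_n) :
  cluster_projections K n 1 Q -> cluster_projections K n 1 Q' -> Q = Q'.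
Proof.
move=> [C [clC ->]] [C' [clC' ->]]; suff -> : C = C' by [].
have full D : is_clustering D -> D = fun _ : 'I_1 => [set: 'I_n]%SET.
  move=> /clustering_index[f fP]; apply/funext => j; apply/setP => i.
  by rewrite fP (ord1 j) (ord1 (f i)) eqxx finset.in_setT.
by rewrite (full _ clC) (full _ clC').
Qed.

(** * Deterministic comparison of original and sketched costs *)

(** In the pairwise form of the cost the weights [Q i j] are nonnegative and the differences do not
    involve [Q], so the same k^2 norms serve every [Q]. *)
Lemma proj_cost_ge_of_preserved (K : realType) (n k d d' : nat) (e : K)
    (R : 'M[K]_(d', d)) (Q : 'M[K]_n) (B : 'M[K]_(n, d))
    (f : 'I_n -> 'I_k) (u : 'I_k -> 'rV[K]_d) :
  Q^T = Q -> Q *m Q = Q -> (forall i, \sum_j Q i j = 1) ->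
  (forall i j, 0 <= Q i j) -> (forall i, row i B = u (f i)) ->
  (forall a b, norm_preserved e R (u a - u b)) ->
  (1 - e) * proj_cost B Q <= proj_cost (B *m R^T) Q.
Proof.
move=> symQ idQ sumQ Q0 rowB uR; rewrite !proj_cost_pairs// mulrCA.
rewrite ler_pM2l ?invr_gt0 ?ltr0n// mulr_sumr; apply: ler_sum => i _.
rewrite mulr_sumr; apply: ler_sum => j _; rewrite mulrCA ler_wpM2l//.
by rewrite !row_mul -mulmxBl !rowB; case/andP: (uR (f i) (f j)).
Qed.

Lemma proj_cost_transfer (K : realType) (n d d' : nat) (e gamma : K)
    (A : 'M[K]_(n, d)) (R : 'M[K]_(d', d)) (Ps Pt : 'M[K]_n) :
  Pt^T = Pt -> Pt *m Pt = Pt -> e < 1 -> 1 <= gamma ->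
  (1 - e) * proj_cost (Ps *m A) Pt <= proj_cost (Ps *m A *m R^T) Pt ->
  frob2 ((A - Ps *m A) *m R^T) <= (1 + e) * proj_cost A Ps ->
  proj_cost (A *m R^T) Pt <= gamma * proj_cost (A *m R^T) Ps ->
  (1 - e) * proj_cost A Pt <= (9 + 3 * e) * gamma * proj_cost A Ps.
Proof.
move=> symPt idPt e1 g1 low up; rewrite (proj_cost_mulr A _ Ps) => opt.
have dec m (M N : 'M[K]_(n, m)) :
    M - Pt *m M = (N - Pt *m N) + ((M - N) - Pt *m (M - N)).
  rewrite mulmxBr addrACA -opprD; congr (_ - _); first by rewrite subrKC.
  by rewrite subrKC.
have ha : proj_cost A Pt <=
    (1 + 2^-1) * proj_cost (Ps *m A) Pt + (1 + 2^-1^-1) * proj_cost A Ps.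
  rewrite {1}/proj_cost (dec _ A (Ps *m A)).
  apply: (le_trans (frob2D_le _ _ (t := 2^-1) _)); first by rewrite invr_gt0.
  by rewrite lerD2l ler_wpM2l ?frob2_proj_le ?addr_ge0 ?invr_ge0.
have hz : proj_cost (Ps *m A *m R^T) Pt <=
    (1 + 1) * proj_cost (A *m R^T) Pt +
    (1 + 1^-1) * frob2 ((A - Ps *m A) *m R^T).
  rewrite {1}/proj_cost (dec _ _ (A *m R^T)).
  apply: (le_trans (frob2D_le _ _ (t := 1) _)) => //.
  rewrite -mulmxBl -[Ps *m A - A]opprB mulNmx mulmxN -opprD frob2N.
  by rewrite lerD2l ler_wpM2l ?frob2_proj_le ?addr_ge0 ?invr_ge0.
rewrite invrK in ha; rewrite invr1 in hz.
have y0 : 0 <= proj_cost A Ps := frob2_ge0 _.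
have w0 : 0 <= frob2 ((A - Ps *m A) *m R^T) := frob2_ge0 _.
move: ha hz low up opt y0 w0.
set a := proj_cost A Pt; set y := proj_cost A Ps; set w := frob2 _.
set x := proj_cost (Ps *m A) Pt; set z := proj_cost _ Pt.
set v := proj_cost _ Pt => ha hz low up opt y0 w0.
(* Here [(1 - e) * x] is at most 2 gamma w + 2 w, hence at most 4 gamma (1 + e) y. The coefficient
   of gamma y becomes 6 (1 + e) + 3 (1 - e) = 9 + 3 e. *)
have h1 : (1 - e) * a <= (1 - e) * ((1 + 2^-1) * x + (1 + 2) * y).
  by rewrite ler_wpM2l// subr_ge0 ltW.
have h2 : gamma * w <= gamma * ((1 + e) * y).
  by rewrite ler_wpM2l// (le_trans _ g1).
have h3 : w <= gamma * w by rewrite ler_peMl.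
have h4 : (1 - e) * y <= gamma * ((1 - e) * y).
  by rewrite ler_peMl// mulr_ge0// subr_ge0 ltW.
by lra.
Qed.

(** * Measurability of the events, and the union bound *)

Section Measurability.
Variables (K : realType) (disp : measure_display) (T : measurableType disp).
Variables (d' d : nat) (R : T -> 'M[K]_(d', d)).
Hypothesis mR : random_matrix R.

Lemma measurable_frob2_mul (m : nat) (M : 'M[K]_(m, d)) :
  measurable_fun [set: T] (fun w => frob2 (M *m (R w)^T)).
Proof.
apply: measurable_sum => i; apply: measurable_sum => j.
apply: measurable_realfun.measurable_funX; under eq_fun do rewrite mxE.
apply: measurable_sum => l; apply: measurable_realfun.measurable_funM => //.
by under eq_fun do rewrite mxE; exact: mR.
Qed.

Lemma measurable_le_set (f g : T -> K) :
  measurable_fun [set: T] f -> measurable_fun [set: T] g ->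
  measurable [set w | f w <= g w].
Proof.
by move=> mf mg; rewrite -[X in measurable X]setTI; exact: measurable_fun_le.
Qed.

Lemma measurable_norm_preserved (e : K) (m : nat) (M : 'M[K]_(m, d)) :
  measurable [set w | norm_preserved e (R w) M].
Proof.
have -> : [set w | norm_preserved e (R w) M] =
    [set w | (1 - e) * frob2 M <= frob2 (M *m (R w)^T)] `&`
    [set w | frob2 (M *m (R w)^T) <= (1 + e) * frob2 M].
  by apply/seteqP; split=> w /andP.
by apply: measurableI; apply: measurable_le_set => //;
  exact: measurable_frob2_mul.
Qed.

Lemma measurable_proj_cost (n : nat) (A : 'M[K]_(n, d)) (Q : 'M[K]_n) :
  measurable_fun [set: T] (fun w => proj_cost (A *m (R w)^T) Q).
Proof.
by under eq_fun do rewrite proj_cost_mulr; exact: measurable_frob2_mul.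
Qed.

End Measurability.

Lemma finite_cluster_projections (K : realType) (n k : nat) :
  finite_set (cluster_projections K n k).
Proof.
(* Finite functions form a finite type, so the projections lie in a finite image. *)
pose proj (C : {ffun 'I_k -> {set 'I_n}}) : 'M[K]_n :=
  cluster_indicator K C *m (cluster_indicator K C)^T.
apply: (@sub_finite_set _ _ (proj @` setT)).
  move=> _ [C [_ ->]]; exists (finfun C) => //=.
  by rewrite /proj (_ : cluster_indicator K (finfun C) = cluster_indicator K C)//;
    apply/matrixP => i j; rewrite !mxE ffunE.
by apply: finite_image; exact: finite_finset.
Qed.

(* If some real gamma violates the implication, so does a slightly larger rational. *)
Lemma ratio_bound_rat (K : realType) (f g a b : K) : 0 <= g ->
  (forall gamma : K, 1 <= gamma -> f <= gamma * g -> a <= gamma * b) <->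
  (forall q : rat, 1 <= ratr q :> K -> f <= ratr q * g -> a <= ratr q * b).
Proof.
move=> g0; split=> [h q|h gamma g1 fg]; first exact: h.
rewrite leNgt; apply/negP => lt_a.
have b1 : 0 < `|b| + 1 by rewrite ltr_wpDl.
(* The interval is short enough that replacing [gamma] by [q] raises the bound by less than the gap
   [a - gamma * b]; the added 1 keeps the divisor positive. *)
have [q /[!in_itv]/= /andP[q1 q2]] : exists q : rat,
    ratr q \in `]gamma, gamma + (a - gamma * b) / (`|b| + 1)[.
  by apply: rat_in_itvoo; rewrite ltrDl divr_gt0 ?subr_gt0.
have := h q (le_trans g1 (ltW q1)).
move=> /(_ (le_trans fg (ler_wpM2r g0 (ltW q1)))); apply/negP; rewrite -ltNge.
move: q2; rewrite -ltrBlDl ltr_pdivlMr// => q2.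
have q0 : 0 <= ratr q - gamma by rewrite subr_ge0 ltW.
have : (ratr q - gamma) * b <= (ratr q - gamma) * (`|b| + 1).
  by rewrite ler_wpM2l// (le_trans (ler_norm b))// lerDl.
by lra.
Qed.

(** Restricting to rational ratios makes the complement a countable union of bad events. *)
Lemma measurable_ratio_bound (K : realType) (disp : measure_display)
    (T : measurableType disp) (f g : T -> K) (a b : K) :
  measurable_fun [set: T] f -> measurable_fun [set: T] g ->
  (forall w, 0 <= g w) ->
  measurable [set w | forall gamma : K,
    1 <= gamma -> f w <= gamma * g w -> a <= gamma * b].
Proof.
move=> mf mg g0.
pose bad (q : rat) := [set w | [/\ 1 <= ratr q :> K, f w <= ratr q * g w &
  ~ a <= ratr q * b]].
have -> : [set w | forall gamma : K,
    1 <= gamma -> f w <= gamma * g w -> a <= gamma * b] = ~` \bigcup_q bad q.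
  apply/seteqP; split=> w /=.
    by move=> h [q _ [q1 fg]]; apply; exact: h.
  move=> h; apply/ratio_bound_rat => // q q1 fg.
  by apply: contrapT => ?; apply: h; exists q.
apply: measurableC; apply: bigcupT_measurable_rat => q.
have -> : bad q = [set w | f w <= ratr q * g w] `&`
    [set w | 1 <= ratr q :> K /\ ~ a <= ratr q * b].
  by apply/seteqP; split=> w /=; [case|case=> ? []].
apply: measurableI.
  by apply: measurable_le_set => //; exact: measurable_realfun.measurable_funM.
(* The remaining conditions do not depend on [w]. *)
have [h|h] := pselect (1 <= ratr q :> K /\ ~ a <= ratr q * b).
  by rewrite (_ : mkset _ = setT)//; apply/seteqP; split.
by rewrite (_ : mkset _ = set0)//; apply/seteqP; split.
Qed.

(** Union bound on the complements; independence is not assumed. *)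
Lemma probability_setI_ge (K : realType) (disp : measure_display)
    (T : measurableType disp) (P : probability T K) (E F : set T) (a b : K) :
  measurable E -> measurable F ->
  ((1 - a)%:E <= P E)%E -> ((1 - b)%:E <= P F)%E ->
  ((1 - (a + b))%:E <= P (E `&` F))%E.
Proof.
move=> mE mF; have finP A : measurable A -> P A = (fine (P A))%:E.
  by move=> mA; rewrite fineK// fin_num_measure.
have mEF := measurableI _ _ mE mF.
have : (P (~` (E `&` F)) <= P (~` E) + P (~` F))%E.
  by rewrite setCI; apply: measureU2; exact: measurableC.
rewrite !probability_setC// (finP _ mE) (finP _ mF) (finP _ mEF).
by rewrite -!EFinB -EFinD !lee_fin; lra.
Qed.

(** There are finitely many projections, so quantifying over them, also inside the argmin condition,
    gives finite intersections; only [gamma] ranges over an infinite set. *)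
Lemma measurable_approx_optimal (K : realType) (disp : measure_display)
    (T : measurableType disp) (n d d' k : nat) (A : 'M[K]_(n, d))
    (R : T -> 'M[K]_(d', d)) (r b : K) : random_matrix R ->
  measurable [set w | forall Ptstar : 'M[K]_n,
    is_argmin (cluster_projections K n k) (proj_cost (A *m (R w)^T)) Ptstar ->
    forall (gamma : K) (Pt : 'M[K]_n),
    1 <= gamma -> cluster_projections K n k Pt ->
    proj_cost (A *m (R w)^T) Pt <= gamma * proj_cost (A *m (R w)^T) Ptstar ->
    proj_cost A Pt <= r * gamma * b].
Proof.
move=> mR; set S := cluster_projections K n k.
pose cost w := proj_cost (A *m (R w)^T).
have finS : finite_set S := @finite_cluster_projections K n k.
rewrite (_ : [set w | _] = \bigcap_(Q in S) \bigcap_(Q' in S)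
  (~` (\bigcap_(Q'' in S) [set w | cost w Q <= cost w Q'']) `|`
   [set w | forall gamma : K, 1 <= gamma ->
      cost w Q' <= gamma * cost w Q -> proj_cost A Q' <= gamma * (r * b)])); last first.
  apply/seteqP; split=> w /=.
    move=> h Q SQ Q' SQ'; have [opt|] := pselect
      ((\bigcap_(Q'' in S) [set w | cost w Q <= cost w Q'']) w); last by left.
    by right=> gamma g1 le_g; rewrite mulrCA mulrA; apply: (h Q) => //; split.
  move=> h Q [SQ opt] gamma Q' g1 SQ' le_g.
  by have [[]//|/(_ gamma g1 le_g)] := h Q SQ Q' SQ'; rewrite mulrCA mulrA.
apply: fin_bigcap_measurable => // Q _; apply: fin_bigcap_measurable => // Q' _.
apply: measurableU.
  apply/measurableC/fin_bigcap_measurable => // Q'' _.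
  by apply: measurable_le_set; exact: measurable_proj_cost.
apply: measurable_ratio_bound; [exact: measurable_proj_cost..|].
by move=> w; exact: frob2_ge0.
Qed.

(* Fails for k = 1: the left side stays above ln 2 while the right side tends to 0
   as delta tends to 1. *)
Lemma ln_sqr_le (K : realType) (k : nat) (delta : K) : (2 <= k)%N ->
  0 < delta < 1 -> ln ((k * k)%:R / (delta / 2)) <= 3 * ln (k%:R / delta).
Proof.
move=> k2 /andP[d0 d1].
have k0 : 0 < k%:R :> K by rewrite ltr0n ltnW.
have q0 : 0 < k%:R / delta by rewrite divr_gt0.
have -> : 3 * ln (k%:R / delta) = ln ((k%:R / delta) ^+ 3).
  by rewrite lnXn// mulr_natl.
rewrite ler_ln ?posrE ?exprn_gt0 ?divr_gt0 ?natrM ?mulr_gt0//.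
(* Cancelling the square leaves 2 delta <= k / delta, which holds as delta^2 <= 1 and k >= 2. *)
have -> : k%:R * k%:R / (delta / 2) = (k%:R / delta) ^+ 2 * (2 * delta) :> K.
  by field; rewrite gt_eqF.
rewrite [leRHS]exprSr ler_pM2l ?exprn_gt0// ler_pdivlMr//.
have : (2 : K) <= k%:R by rewrite ler_nat.
have : delta * delta <= 1 by rewrite mulr_ile1 ?ltW.
by lra.
Qed.

(** * Choice of constants and the probability estimate *)

Theorem theorem19 (K : realType) (c : K) (hc : 0 < c) :
  exists2 c0 : K, 0 < c0 &
  forall (n d d' k : nat) (A : 'M[K]_(n, d)) (eps delta : K)
    (disp : measure_display) (T : measurableType disp) (P : probability T K)
    (R : T -> 'M[K]_(d', d)) (Pstar : 'M[K]_n),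
  (1 <= k)%N -> 0 <= eps < 1 -> 0 < delta < 1 ->
  random_matrix R ->
  johnson_lindenstrauss c P R ->
  c0 * ln (k%:R / delta) <= d'%:R * eps ^+ 2 ->
  is_argmin (cluster_projections K n k) (proj_cost A) Pstar ->
  let At w := A *m (R w)^T in
  let good := [set w | forall Ptstar : 'M[K]_n,
    is_argmin (cluster_projections K n k) (proj_cost (At w)) Ptstar ->
    forall (gamma : K) (Pt : 'M[K]_n),
    1 <= gamma -> cluster_projections K n k Pt ->
    proj_cost (At w) Pt <= gamma * proj_cost (At w) Ptstar ->
    proj_cost A Pt <= (9 + eps) * gamma * proj_cost A Pstar] in
  measurable good /\ ((1 - delta)%:E <= P good)%E.
Proof.
(* The 3 pays for [ln_sqr_le], the 13^2 for replacing [eps] by [eps / 13]. *)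
exists (3 * 13 ^+ 2 * c); first by rewrite !mulr_gt0.
move=> n d d' k A eps delta disp T P R Pstar k1 /andP[eps0 eps1] delta01 mR JL.
move=> hd' [SPstar optA] At good.
have cost0 m (M : 'M[K]_(n, m)) Q : 0 <= proj_cost M Q by exact: frob2_ge0.
have [d0 d1] := andP delta01.
have mgood : measurable good by exact: measurable_approx_optimal.
split=> //; move: k1; rewrite leq_eqVlt => /predU1P[k1|k2].
  (* For k = 1 every competitor equals [Pstar], and (9 + eps) gamma >= 1, so the bound holds
     surely. *)
  rewrite (_ : good = setT) ?probability_setT ?lee_fin ?lerBlDr ?lerDl ?ltW//.
  apply/seteqP; split=> // w _ Q _ gamma Q' g1 SQ' _.
  subst k; rewrite (cluster_projection1_uniq SQ' SPstar).
  by rewrite ler_peMl//; nra.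
have lnpos : 0 < ln (k%:R / delta).
  by rewrite ln_gt0// ltr_pdivlMr// mul1r (lt_le_trans d1)// ler1n (ltnW k2).
(* With [eps] zero, the row condition would bound a positive number by 0. *)
have {}eps0 : 0 < eps.
  rewrite lt_neqAle eps0 andbT; apply/eqP => eps_eq0; move: hd'.
  by rewrite -eps_eq0 expr0n/= mulr0 leNgt !mulr_gt0.
(* With eps = 13 e, (1 - e) (9 + eps) - (9 + 3 e) = e (1 - eps) >= 0. *)
pose e := eps / 13.
have e01 : 0 < e < 1 by rewrite /e; lra.
(* Each of the two events may fail with probability [delta / 2]; halving also meets the cap 1/2 in
   [johnson_lindenstrauss]. *)
have del : 0 < delta / 2 <= 2^-1 by lra.
have [JLvec JLmx] := JL e (delta / 2) e01 del.
have lnk := ln_sqr_le k2 delta01.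
have hrows : c * ln ((k * k)%:R / (delta / 2)) <= d'%:R * e ^+ 2.
  have : c * ln ((k * k)%:R / (delta / 2)) <= c * (3 * ln (k%:R / delta)).
    by rewrite ler_pM2l.
  rewrite /e; move: hd'; rewrite exprMn; move: (ln _) (ln _) => x y.
  by lra.
have hrows1 : c * ln (1 / (delta / 2)) <= d'%:R * e ^+ 2.
  apply: le_trans hrows; rewrite ler_pM2l// ler_ln ?posrE ?divr_gt0 ?ltr0n//.
    by rewrite ler_pM2r ?invr_gt0 ?divr_gt0// ler1n muln_gt0 !(ltnW k2).
  by rewrite muln_gt0 !(ltnW k2).
have [f [u fu]] := cluster_projection_rows A SPstar.
(* All ordered pairs of centers, enumerated as one family of k^2 vectors. *)
pose v (i : 'I_#|{: 'I_k * 'I_k}|) : 'rV[K]_d :=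
  u (enum_val i).1 - u (enum_val i).2.
have vE a b : u a - u b = v (enum_rank (a, b)) by rewrite /v enum_rankK.
have cardkk : #|{: 'I_k * 'I_k}| = (k * k)%N by rewrite card_prod !card_ord.
have : ((1 - delta / 2)%:E <=
    P [set w | forall i, norm_preserved e (R w) (v i)])%E.
  by apply: JLvec; rewrite cardkk// muln_gt0 !(ltnW k2).
have := JLmx _ (A - Pstar *m A) hrows1.
set Emx := [set w | _]; set Evec := [set w | _] => Pmx Pvec.
have mEmx : measurable Emx by exact: measurable_norm_preserved.
have mEvec : measurable Evec.
  rewrite (_ : Evec = \bigcap_(i in setT) [set w | norm_preserved e (R w) (v i)]).
    apply: fin_bigcap_measurable; first exact: finite_finset.
    by move=> i _; exact: measurable_norm_preserved.
  by apply/seteqP; split=> w h i; [move=> _; exact: h|exact: (h i I)].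
have := probability_setI_ge mEvec mEmx Pvec Pmx.
rewrite -splitr => /le_trans; apply; apply: le_measure; rewrite ?inE//.
  exact: measurableI.
move=> w [Ew1 /andP[_ up]] Q [SQ optQ] gamma Q' g1 SQ' leQ'.
have [symQ idQ sumQ Q0] := cluster_projection_facts SQ'.
have low : (1 - e) * proj_cost (Pstar *m A) Q' <=
    proj_cost (Pstar *m A *m (R w)^T) Q'.
  apply: (proj_cost_ge_of_preserved symQ idQ sumQ Q0 fu) => a b.
  by rewrite vE; exact: Ew1.
have e1 : e < 1 by case/andP: e01.
have := proj_cost_transfer symQ idQ e1 g1 low up.
have g0 : 0 <= gamma by exact: le_trans g1.
(* The sketched optimum costs no more than [Pstar] on the sketch, so [Q'] is also
   [gamma]-competitive with [Pstar] there. *)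
move=> /(_ (le_trans leQ' (ler_wpM2l g0 (optQ _ SPstar)))) main.
rewrite -(ler_pM2l (_ : 0 < 1 - e)) ?subr_gt0//; apply: (le_trans main).
rewrite !mulrA ler_wpM2r// ler_wpM2r//.
by rewrite /e; nra.
Qed.
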